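(* Let $\pi=(\pi_1,\dots,\pi_D)$ be a probability vector with $\pi_j>0$ for all $j$, and suppose the simulation outputs $X_{i,j}$ are normal with mean $\mu_{i,j}$ and variance $\sigma_{i,j}^2>0$, with all samples independent over $i,j$ and replications. Let $b$ be the unique maximizer of $\bar\mu_i=\sum_{j=1}^D\pi_j\mu_{i,j}$. Let $\alpha=(\alpha_{i,j})\ge 0$ be a feasible allocation policy (i.e. $\sum_{i=1}^K\sum_{j=1}^D\alpha_{i,j}=1$). Then $\alpha$ is optimal for $$\max_{\alpha,\,z}\ z\quad\text{s.t.}\quad \mathbf G_i(\alpha_b,\alpha_i)-z\ge 0\ (i\ne b),\quad \sum_{i=1}^K\sum_{j=1}^D\alpha_{i,j}=1,\quad \alpha_{i,j}\ge 0\ (1\le i\le K,\ 1\le j\le D)\qquad (P)$$ if and only if the following three conditions hold: 1. (Input Balance) $\dfrac{\partial \mathbf G_i(\alpha_b,\alpha_i)}{\partial \alpha_{i,j}}=\dfrac{\partial \mathbf G_i(\alpha_b,\alpha_i)}{\partial \alpha_{i,j'}}$ for all $i\ne b$ and $1\le j<j'\le D$; 2. (Total Balance) $\displaystyle\sum_{i\ne b}\frac{\partial \mathbf G_i(\alpha_b,\alpha_i)/\partial\alpha_{b,j}}{\partial \mathbf G_i(\alpha_b,\alpha_i)/\partial\alpha_{i,j}}=1$ for all $1\le j\le D$; 3. (Local Balance) $\mathbf G_i(\alpha_b,\alpha_i)=\mathbf G_{i'}(\alpha_b,\alpha_{i'})$ for all distinct $i,i'$ both different from $b$. Equivalently, in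 explicit form: 1. $\dfrac{\alpha_{i,j}}{\sigma_{i,j}\pi_j}=\dfrac{\alpha_{i,j'}}{\sigma_{i,j'}\pi_{j'}}$ for all $i\ne b$ and all $1\le j,j'\le D$; 2. $\left(\dfrac{\alpha_{b,j}}{\sigma_{b,j}}\right)^2=\displaystyle\sum_{i\ne b}\left(\dfrac{\alpha_{i,j}}{\sigma_{i,j}}\right)^2$ for all $1\le j\le D$; 3. $\dfrac{(\bar\mu_b-\bar\mu_i)^2}{\sum_{j=1}^D\frac{\sigma_{b,j}^2\pi_j^2}{\alpha_{b,j}}+\sum_{j=1}^D\frac{\sigma_{i,j}^2\pi_j^2}{\alpha_{i,j}}}=\dfrac{(\bar\mu_b-\bar\mu_{i'})^2}{\sum_{j=1}^D\frac{\sigma_{b,j}^2\pi_j^2}{\alpha_{b,j}}+\sum_{j=1}^D\frac{\sigma_{i',j}^2\pi_j^2}{\alpha_{i',j}}}$ for all distinct $i,i'$ both different from $b$. Furthermore, the optimal solution $\alpha^*$ of $(P)$ is unique.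
   Context: There are $K\ge 2$ designs $i\in\{1,\dots,K\}$ and $D\ge1$ input parameters $j\in\{1,\dots,D\}$. $\alpha_{i,j}$ is the fraction of the total simulation budget $n$ given to simulating design $i$ under input parameter $j$, and $\alpha_i=(\alpha_{i,1},\dots,\alpha_{i,D})$. With $\hat\mu_i(\alpha_i,n)=\sum_j\pi_j\frac1{\alpha_{i,j}n}\sum_{s=1}^{\alpha_{i,j}n}X_{i,j}^{(s)}$ (ignoring integrality), the rate function is $\mathbf G_i(\alpha_b,\alpha_i):=-\lim_{n\to\infty}\frac1n\log \mathbf P(\hat\mu_b(\alpha_b,n)\le\hat\mu_i(\alpha_i,n))$ for $i\neq b$, which for the Gaussian outputs considered is given by $$\mathbf G_i(\alpha_b,\alpha_i)=\frac{(\bar\mu_b-\bar\mu_i)^2}{2\left(\sum_{j=1}^D\frac{\sigma_{b,j}^2\pi_j^2}{\alpha_{b,j}}+\sum_{j=1}^D\frac{\sigma_{i,j}^2\pi_j^2}{\alpha_{i,j}}\right)},$$ with the conventions $a/0=+\infty$ for $a>0$ and $a/\infty=0$ (so $\mathbf G_i=0$ if some $\alpha_{b,j}$ or $\alpha_{i,j}$ is $0$). The derivative conditions are understood to include that the displayed derivatives and quotients are defined. *)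

(* Defs.v *)
From HB Require Import structures.
From mathcomp Require Import all_boot all_order all_algebra.
From mathcomp Require Import all_classical all_reals all_analysis.

Set Implicit Arguments.
Unset Strict Implicit.
Unset Printing Implicit Defensive.

Import Order.TTheory GRing.Theory Num.Theory.
Import numFieldNormedType.Exports.

Local Open Scope classical_set_scope.
Local Open Scope ring_scope.

(* Product rule over every finite subfamily. *)
Definition mutually_independent d (T : measurableType d) (R : realType)
    (P : probability T R) (I : choiceType) (X : I -> {RV P >-> R}) : Prop :=
  forall (s : seq I) (B : I -> set R), uniq s ->
    (forall k, measurable (B k)) ->
    P (\bigcap_(k in [set` s]) X k @^-1` B k)
    = (\prod_(k <- s) P (X k @^-1` B k))%E.

Section Model.
Context d (T : measurableType d) (R : realType) (P : probability T R).
Context (K D : nat).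
Implicit Types (X : 'I_K -> 'I_D -> nat -> {RV P >-> R}) (p : 'I_D -> R).
Implicit Types (a ab ai : 'rV[R]_D).

(* The second argument of normal_prob is the standard deviation. *)
Definition gaussian_outputs (mu sigma : 'I_K -> 'I_D -> R) X : Prop :=
  (forall i j s (B : set R), measurable B ->
     distribution P (X i j s) B = normal_prob (mu i j) (sigma i j) B) /\
  mutually_independent
    (fun k : 'I_K * 'I_D * nat => X k.1.1 k.1.2 k.2).

(* a_j n need not be an integer: the number of replications is its floor. *)
Definition mu_hat p X (i : 'I_K) a (n : nat) (w : T) : R :=
  \sum_(j < D) p j *
    ((Num.truncn (a 0 j * n%:R))%:R^-1 *
     \sum_(s < Num.truncn (a 0 j * n%:R)) X i j s w).

(* The rate is 0 by convention when some component is 0, the empirical mean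
   being undefined there; components < 0 lie outside the domain of G and get
   the same value.  Hence G has a kink, and no partial derivative, at 0 along a
   coordinate when all the other components are positive. *)
Definition G p X (b i : 'I_K) ab ai : R :=
  if [forall j, (0 < ab 0 j) && (0 < ai 0 j)] then
    - lim ((fun n : nat =>
        n%:R^-1 *
        ln (fine (P [set w | mu_hat p X b ab n w <= mu_hat p X i ai n w])))
      @ \oo)
  else 0.

End Model.

Definition mean (R : realType) (K D : nat) (p : 'I_D -> R)
    (mu : 'I_K -> 'I_D -> R) (i : 'I_K) : R :=
  \sum_(j < D) p j * mu i j.

Section Allocation.
Context (R : realType) (K D : nat).
Implicit Types (al : 'M[R]_(K, D)) (b : 'I_K).

Definition allocation al : Prop :=
  (forall i j, 0 <= al i j) /\ \sum_(i < K) \sum_(j < D) al i j = 1.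

Section RateFunctions.
Variable g : 'I_K -> 'rV[R]_D -> 'rV[R]_D -> R.

Definition feasible b al (z : R) : Prop :=
  (forall i, i != b -> 0 <= g i (row b al) (row i al) - z) /\ allocation al.

Definition optimal b al : Prop :=
  exists z, feasible b al z /\
    forall al' z', feasible b al' z' -> z' <= z.

(* Partial derivatives of g i at (ab, ai), in the j-th component of the first
   and of the second argument. *)
Definition derivable_b i (j : 'I_D) ab ai : Prop :=
  derivable (fun a => g i a ai) ab (delta_mx 0 j).
Definition derivable_i i (j : 'I_D) ab ai : Prop :=
  derivable (g i ab) ai (delta_mx 0 j).
Definition partial_b i (j : 'I_D) ab ai : R :=
  'D_(delta_mx 0 j) (fun a => g i a ai) ab.
Definition partial_i i (j : 'I_D) ab ai : R :=
  'D_(delta_mx 0 j) (g i ab) ai.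

Definition input_balance b al : Prop :=
  forall (i : 'I_K) (j j' : 'I_D), i != b -> (j < j')%N ->
    [/\ derivable_i i j (row b al) (row i al),
        derivable_i i j' (row b al) (row i al) &
        partial_i i j (row b al) (row i al)
        = partial_i i j' (row b al) (row i al)].

Definition total_balance b al : Prop :=
  forall j : 'I_D,
    (forall i, i != b ->
       [/\ derivable_b i j (row b al) (row i al),
           derivable_i i j (row b al) (row i al) &
           partial_i i j (row b al) (row i al) != 0]) /\
    \sum_(i < K | i != b)
      partial_b i j (row b al) (row i al) /
      partial_i i j (row b al) (row i al) = 1.

Definition local_balance b al : Prop :=
  forall i i' : 'I_K, i != b -> i' != b -> i != i' ->
    g i (row b al) (row i al) = g i' (row b al) (row i' al).

End RateFunctions.

Section Explicit.
Variables (p : 'I_D -> R) (mu sigma : 'I_K -> 'I_D -> R).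

Definition input_balance_explicit b al : Prop :=
  forall (i : 'I_K) (j j' : 'I_D), i != b ->
    al i j / (sigma i j * p j) = al i j' / (sigma i j' * p j').

Definition total_balance_explicit b al : Prop :=
  forall j : 'I_D,
    (al b j / sigma b j) ^+ 2 = \sum_(i < K | i != b) (al i j / sigma i j) ^+ 2.

(* n times the variance of the empirical mean of design i.  The quotients are
   taken in \bar R, where 0^-1 = +oo and +oo^-1 = 0. *)
Definition mean_variance i al : \bar R :=
  (\sum_(j < D) (sigma i j ^+ 2 * p j ^+ 2)%:E / (al i j)%:E)%E.

Definition local_balance_explicit b al : Prop :=
  forall i i' : 'I_K, i != b -> i' != b -> i != i' ->
    (((mean p mu b - mean p mu i) ^+ 2)%:E
       / (mean_variance b al + mean_variance i al)
     = ((mean p mu b - mean p mu i') ^+ 2)%:E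
       / (mean_variance b al + mean_variance i' al))%E.

End Explicit.
End Allocation.

(* Main.v *)
(** The difference of two empirical means is a linear combination of independent
normal variables, hence normal with mean [- delta] and variance [V_n] where
[n * V_n] tends to [V]; bounding the normal tail on both sides by
[exp (- delta ^ 2 / (2 V_n))] up to subexponential factors gives the rate
[delta ^ 2 / (2 V)] as soon as all components are positive.

Each of the two systems of balance conditions says that
[alpha l j = sigma l j * p j * x l] for some [x > 0] with
[x b ^ 2 = \sum_(i != b) x i ^ 2] and with all the rates equal to some [z].
If [alpha'] has rates at least [z], then its variances [V_i] are at most those
of [alpha]; weighting these inequalities by [x i ^ 2] and bounding each convex
term [c / a] from below by its tangent, the linear parts add up to
[\sum alpha' - \sum alpha = 0], so that strict convexity forces
[alpha' = alpha].  Thus such an [alpha] is the unique optimum.  One exists: with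
[x b = 1] and [w l = \sum_j sigma l j * p j], equal rates mean
[x i = w i * t / (delta i ^ 2 - w b * t)], and the parameter [t] is found by the
intermediate value theorem. *)

Require Import Defs.
From HB Require Import structures.
From mathcomp Require Import all_boot all_order all_algebra.
From mathcomp Require Import all_classical all_reals all_analysis.
From mathcomp Require Import measurable_realfun ring lra.

Set Implicit Arguments.
Unset Strict Implicit.
Unset Printing Implicit Defensive.

Import Order.TTheory GRing.Theory Num.Theory.
Import numFieldNormedType.Exports.
Local Open Scope classical_set_scope.
Local Open Scope ring_scope.

(** * Gaussian laws *)

Section affine.
Context {R : realType}.
Implicit Types (A : set R) (c e m s : R).
Notation lambda := (@lebesgue_measure R).

Lemma measurable_affine c e :
  measurable_fun setT ((fun x => c * x + e) : R -> R).
Proof. by by apply: measurable_funD => //; exact: measurable_funM. Qed.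

(** Kept as a pushforward and made a measure, so that uniqueness of Lebesgue measure can be applied
    to its multiple by [|c|]. *)
Definition affine_image c e : set (measurableTypeR R) -> \bar R :=
  pushforward lambda ((fun x => c * x + e) : measurableTypeR R -> measurableTypeR R).

Let affine_image0 c e : affine_image c e set0 = 0%E.
Proof. by rewrite /affine_image /pushforward preimage_set0 measure0. Qed.

Let affine_image_ge0 c e A : (0 <= affine_image c e A)%E.
Proof. by rewrite /affine_image /pushforward measure_ge0. Qed.

Let affine_image_sigma_additive c e : semi_sigma_additive (affine_image c e).
Proof. by apply: measure_semi_sigma_additive; exact: measurable_affine. Qed.

HB.instance Definition _ c e := isMeasure.Build _ _ _ (affine_image c e)
  (affine_image0 c e) (affine_image_ge0 c e) (@affine_image_sigma_additive c e).

(** The right-hand side is a measure in [A] giving each half-open interval its length, which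
    characterizes Lebesgue measure. *)
Lemma lebesgue_measure_affine c e A : c != 0 -> measurable A ->
  (lambda A = `|c|%:E * lambda ((fun x => c * x + e)%R @^-1` A))%E.
Proof.
move=> c0 mA.
rewrite -[RHS]/(mscale (NngNum (normr_ge0 c)) (affine_image c e) A).
apply: lebesgue_measure_unique =>// _ [[a b]] _ <-.
rewrite -[RHS]/(`|c|%:E * lambda ((fun x => (c * x + e)%R) @^-1` `]a, b]%classic))%E.
have [cp|cn|c00] := ltgtP c 0; last by rewrite c00 eqxx in c0.
(* Here [c < 0]: the endpoints are exchanged, and the closed end of the preimage is the left one. *)
- rewrite [X in (_ * lambda X)%E](_ : _ = `[(b - e) / c, (a - e) / c[%classic); last first.
    apply/seteqP; split => x /=; rewrite !in_itv/= => /andP[h1 h2].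
      rewrite ler_ndivrMr // ltr_ndivlMr // mulrC; apply/andP; split; lra.
    move: h1 h2; rewrite ler_ndivrMr // ltr_ndivlMr // => h1 h2.
    by apply/andP; split; lra.
  rewrite !lebesgue_measure_itv/= !lte_fin ltr_ndivrMr// divfK// ltrD2r.
  case: ifPn => ab; last by rewrite mule0.
  rewrite -!EFinB -EFinM ltr0_norm//; congr EFin; by field.
- rewrite [X in (_ * lambda X)%E](_ : _ = `](a - e) / c, (b - e) / c]%classic); last first.
    apply/seteqP; split => x /=; rewrite !in_itv/= => /andP[h1 h2].
      rewrite ler_pdivlMr // ltr_pdivrMr // mulrC; apply/andP; split; lra.
    move: h1 h2; rewrite ler_pdivlMr // ltr_pdivrMr // => h1 h2.
    by apply/andP; split; lra.
  rewrite !lebesgue_measure_itv/= !lte_fin ltr_pdivrMr// divfK// ltrD2r.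
  case: ifPn => ab; last by rewrite mule0.
  rewrite -!EFinB -EFinM gtr0_norm//; congr EFin; by field.
Qed.

Lemma normal_pdf_affine c e m s x : c != 0 -> s != 0 ->
  `|c| * normal_pdf (c * m + e) (c * s) (c * x + e) = normal_pdf m s x.
Proof.
move=> c0 s0; rewrite !normal_pdfE ?mulf_neq0// /normal_peak /normal_fun.
have -> : - (c * x + e - (c * m + e)) ^+ 2 / ((c * s) ^+ 2 *+ 2)
        = - (x - m) ^+ 2 / (s ^+ 2 *+ 2).
  by field; rewrite c0 s0.
rewrite mulrA; congr (_ * _).
have -> : (c * s) ^+ 2 * pi *+ 2 = c ^+ 2 * (s ^+ 2 * pi *+ 2) by ring.
rewrite sqrtrM ?sqr_ge0// sqrtr_sqr invfM mulrA.
by rewrite divff ?mul1r// normr_eq0.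
Qed.

(** Change of variables, the Jacobian [|c|] being absorbed by the peak of the density. The deviation
    [c * s] may be negative: the density depends only on its square. *)
Lemma normal_prob_affine c e m s A : c != 0 -> s != 0 -> measurable A ->
  normal_prob m s ((fun x => c * x + e) @^-1` A)
  = normal_prob (c * m + e) (c * s) A.
Proof.
move=> c0 s0 mA; rewrite /normal_prob.
have mpdf : measurable_fun A (fun x => (normal_pdf (c * m + e) (c * s) x)%:E).
  by apply/measurable_EFinP/measurable_funTS; exact: measurable_normal_pdf.
transitivity (\int[mscale (NngNum (normr_ge0 c)) (affine_image c e)]_(x in A)
    (normal_pdf (c * m + e) (c * s) x)%:E)%E; last first.
  apply: eq_measure_integral => B mB _.
  exact/esym/(lebesgue_measure_affine e c0 mB).
rewrite ge0_integral_mscale//=; last first.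
  by move=> x _; rewrite lee_fin normal_pdf_ge0.
rewrite ge0_integral_pushforward//=; last 2 first.
- exact: measurable_affine.
- by move=> x _; rewrite lee_fin normal_pdf_ge0.
rewrite -ge0_integralZl//=.
- by apply: eq_integral => x _; rewrite -EFinM normal_pdf_affine.
- rewrite -[X in measurable X]setTI; exact: measurable_affine.
- apply/measurable_EFinP/measurable_funTS.
  apply: measurableT_comp; first exact: measurable_normal_pdf.
  exact: measurable_affine.
- by move=> x _; rewrite lee_fin normal_pdf_ge0.
Qed.

End affine.

(** * Convolution of two normal laws *)

Section convolution.
Context {R : realType}.
Implicit Types (A : set R) (m s x z : R).
Notation lambda := (@lebesgue_measure R).

(** The Radon-Nikodym derivative of the normal law agrees almost everywhere with [normal_pdf], both
    having the same integral over every measurable set. *)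
Lemma ge0_integral_normal_prob m s (f : R -> \bar R) :
  measurable_fun setT f -> (forall x, 0 <= f x)%E ->
  (\int[normal_prob m s]_x f x = \int[lambda]_x (f x * (normal_pdf m s x)%:E))%E.
Proof.
move=> mf f0; have dom := normal_prob_dominates m s.
rewrite -(Radon_Nikodym_SigmaFinite.change_of_variables dom)//.
apply: ae_eq_integral => //.
- apply: emeasurable_funM => //.
  exact: measurable_int (Radon_Nikodym_SigmaFinite.f_integrable dom).
- apply: emeasurable_funM => //.
  by apply/measurable_EFinP; exact: measurable_normal_pdf.
- apply: ae_eqe_mul2l => /=.
  apply: integral_ae_eq => //=.
  + exact: Radon_Nikodym_SigmaFinite.f_integrable.
  + by apply/measurable_EFinP; exact: measurable_normal_pdf.
  + by move=> B _ mB; rewrite -Radon_Nikodym_SigmaFinite.f_integral.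
Qed.

Lemma normal_pdf_shift m s x z : s != 0 ->
  normal_pdf (m + x) s z = normal_pdf m s (z - x).
Proof. by move=> s0; rewrite !normal_pdfE// /normal_fun opprD addrA addrAC. Qed.

(** Completing the square in [x]: the joint density factors into the density of the sum [z] and the
    conditional density of the first summand given [z]. *)
Lemma normal_pdfM m1 s1 m2 s2 x z : s1 != 0 -> s2 != 0 ->
  let S := s1 ^+ 2 + s2 ^+ 2 in
  normal_pdf m1 s1 x * normal_pdf m2 s2 (z - x)
  = normal_pdf (m1 + m2) (Num.sqrt S) z
    * normal_pdf ((m1 * s2 ^+ 2 + (z - m2) * s1 ^+ 2) / S) (s1 * s2 / Num.sqrt S) x.
Proof.
move=> s10 s20 S.
have S0 : 0 < S by rewrite addr_gt0// exprn_even_gt0.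
have rS0 : Num.sqrt S != 0 by rewrite gt_eqF// sqrtr_gt0.
have rS2 : Num.sqrt S ^+ 2 = S by rewrite sqr_sqrtr// ltW.
rewrite !normal_pdfE ?mulf_neq0 ?invr_eq0// /normal_peak /normal_fun.
rewrite !exprMn !exprVn rS2 mulrACA [RHS]mulrACA -!expRD -!invfM.
rewrite -!sqrtrM; last 2 first.
- by rewrite mulrn_wge0// mulr_ge0 ?pi_ge0// ltW.
- by rewrite mulrn_wge0// mulr_ge0 ?pi_ge0// sqr_ge0.
have Sn0 : S != 0 by rewrite gt_eqF.
congr ((Num.sqrt _)^-1 * expR _); first by field.
rewrite /S in Sn0 *; field; rewrite s10 s20 Sn0 //.
Qed.

(** After exchanging the integrals by Tonelli, [normal_pdfM] leaves the density of the sum times a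
    normal density in [x], which integrates to 1. *)
Lemma normal_prob_convolution m1 s1 m2 s2 A : s1 != 0 -> s2 != 0 -> measurable A ->
  (\int[normal_prob m1 s1]_x normal_prob m2 s2 ((fun y => (x + y)%R) @^-1` A)
   = normal_prob (m1 + m2) (Num.sqrt (s1 ^+ 2 + s2 ^+ 2)) A)%E.
Proof.
move=> s10 s20 mA.
pose k (xz : R * R) : \bar R := (normal_pdf m2 s2 (xz.2 - xz.1) * \1_A xz.2)%:E.
have k0 xz : (0 <= k xz)%E by rewrite lee_fin mulr_ge0 ?normal_pdf_ge0.
have mk : measurable_fun setT k.
  apply/measurable_EFinP; apply: measurable_funM.
    apply: measurableT_comp; first exact: measurable_normal_pdf.
    by apply: measurable_funB => //.
  by apply: measurableT_comp => //.
have inner x : (normal_prob m2 s2 ((fun y => (x + y)%R) @^-1` A)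
    = \int[lambda]_z k (x, z))%E.
  have -> : (fun y => x + y) @^-1` A = (fun y => 1 * y + x) @^-1` A.
    by apply/seteqP; split => y /=; rewrite mul1r addrC.
  rewrite normal_prob_affine ?oner_eq0// !mul1r /normal_prob.
  rewrite integral_mkcond; apply: eq_integral => z _.
  rewrite /k/= patchE /indic; case: ifPn => zA; last by rewrite mulr0.
  by rewrite mulr1 -normal_pdf_shift.
under eq_integral do rewrite inner.
rewrite ge0_integral_normal_prob; last 2 first.
- exact: measurable_fun_fubini_tonelli_F.
- by move=> x; apply: integral_ge0.
pose f xz := (k xz * (normal_pdf m1 s1 xz.1)%:E)%E.
have f0 xz : (0 <= f xz)%E by rewrite mule_ge0// lee_fin normal_pdf_ge0.
have mf : measurable_fun setT f.
  apply: emeasurable_funM => //; apply/measurable_EFinP.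
  by apply: measurableT_comp; first exact: measurable_normal_pdf.
transitivity (\int[lambda]_x \int[lambda]_z f (x, z))%E.
  apply: eq_integral => x _; rewrite /f/= ge0_integralZr//.
  - exact: measurableT_comp.
  - by rewrite lee_fin normal_pdf_ge0.
transitivity (\int[lambda]_z \int[lambda]_x f (x, z))%E.
  exact: fubini_tonelli.
rewrite /normal_prob [RHS]integral_mkcond; apply: eq_integral => z _.
rewrite patchE /f /k/= /indic; case: ifPn => zA; last first.
  by rewrite integral0_eq// => x _; rewrite mulr0 mul0e.
under eq_integral => x _.
  rewrite mulr1 -EFinM mulrC normal_pdfM// EFinM. over.
rewrite ge0_integralZl//=.
- by rewrite integral_normal_pdf mule1.
- by apply/measurable_EFinP; exact: measurable_normal_pdf.
- by move=> x _; rewrite lee_fin normal_pdf_ge0.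
- by rewrite lee_fin normal_pdf_ge0.
Qed.

End convolution.

(** A product measure is determined by its values on rectangles. Here [mu] is any measure, so that
    it can be a probability restricted to an event. *)
Lemma pushforward_pair_product d d1 d2 (T : measurableType d)
    (T1 : measurableType d1) (T2 : measurableType d2) (R : realType)
    (mu : {measure set T -> \bar R}) (m1 : {sigma_finite_measure set T1 -> \bar R})
    (m2 : {sigma_finite_measure set T2 -> \bar R}) (f : T -> T1) (g : T -> T2) :
  measurable_fun setT f -> measurable_fun setT g ->
  (forall A B, measurable A -> measurable B ->
     mu (f @^-1` A `&` g @^-1` B) = m1 A * m2 B)%E ->
  forall C, measurable C -> mu ((fun w => (f w, g w)) @^-1` C) = (m1 \x m2)%E C.
Proof.
move=> mf mg fg C mC.
rewrite -[LHS]/(pushforward mu (fun w => (f w, g w)) C).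
apply/esym; apply: product_measure_unique => //.
exact: measurable_fun_pair.
Qed.

(** * Weighted sums of independent normal variables *)

Section sum_of_independent_normals.
Context d (T : measurableType d) (R : realType) (P : probability T R).
Context (I : choiceType) (X : I -> {RV P >-> R}) (m s c : I -> R).
Hypothesis Xind : mutually_independent X.
Hypothesis Xnormal : forall k (B : set R), measurable B ->
  distribution P (X k) B = normal_prob (m k) (s k) B.
Hypothesis s0 : forall k, s k != 0.
Hypothesis c0 : forall k, c k != 0.
Implicit Types (L t : seq I) (A : set R) (B : I -> set R).

Let event t B : set T := \bigcap_(k in [set` t]) X k @^-1` B k.

Let measurable_event t B : (forall k, measurable (B k)) -> measurable (event t B).
Proof.
move=> mB; apply: fin_bigcap_measurable => // k _; exact: measurable_funPTI.
Qed.

Let event_cons k t A B : k \notin t ->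
  X k @^-1` A `&` event t B = event (k :: t) (fun l => if l == k then A else B l).
Proof.
move=> kt; rewrite /event !bigcap_seq big_cons eqxx; congr (_ `&` _).
apply: eq_big_seq => l /= lt; case: eqVneq => // lk.
by rewrite -lk lt in kt.
Qed.

Let event_consM k t A B : uniq (k :: t) -> measurable A ->
  (forall l, measurable (B l)) ->
  (P (X k @^-1` A `&` event t B) = normal_prob (m k) (s k) A * P (event t B))%E.
Proof.
move=> /= /andP[kt ut] mA mB; rewrite event_cons// Xind/= ?kt//; last first.
  by move=> l; case: ifP.
rewrite big_cons eqxx Xind//; congr (_ * _)%E; first exact: Xnormal.
apply: eq_big_seq => l lt; case: eqVneq => // lk.
by rewrite -lk lt in kt.
Qed.

Let wsum L w : R := \sum_(k <- L) c k * X k w.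
Let wmean L : R := \sum_(k <- L) c k * m k.
Let wsd L : R := Num.sqrt (\sum_(k <- L) (c k * s k) ^+ 2).

Let measurable_wsum L : measurable_fun setT (wsum L).
Proof.
apply: measurable_sum => k.
apply: measurable_funM => //; exact: measurable_funPT.
Qed.

(** A sum with one term has deviation [Num.sqrt ((c k * s k) ^+ 2)], that is, the absolute value of
    [c k * s k]. *)
Lemma normal_prob_sd_norm mm ss A : normal_prob mm `|ss| A = normal_prob mm ss A :> \bar R.
Proof.
rewrite /normal_prob; apply: eq_integral => x _; congr EFin.
by rewrite /normal_pdf normr_eq0 /normal_fun /normal_peak real_normK ?num_real.
Qed.

Let wsd_neq0 k L : wsd (k :: L) != 0.
Proof.
rewrite /wsd big_cons gt_eqF// sqrtr_gt0 ltr_wpDr ?sumr_ge0//.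
  by move=> ? _; exact: sqr_ge0.
by rewrite exprn_even_gt0//= mulf_neq0.
Qed.

Let scaled_event k A : measurable A -> measurable ((fun x => c k * x + 0) @^-1` A).
Proof.
by move=> mA; rewrite -[X in measurable X]setTI; exact: measurable_affine.
Qed.

Let scaled_law k A : measurable A ->
  normal_prob (m k) (s k) ((fun x => c k * x + 0) @^-1` A)
  = normal_prob (c k * m k) (c k * s k) A.
Proof. by move=> mA; rewrite normal_prob_affine// addr0. Qed.

(* Carrying along an event of the remaining variables makes the induction on
   [L] go through: the product rule extends from rectangles to
   [(c k * X k, wsum L)] by uniqueness of the product measure. *)
Let weighted_sum_event k L t A B : uniq ((k :: L) ++ t) ->
  (forall l, measurable (B l)) -> measurable A ->
  (P (wsum (k :: L) @^-1` A `&` event t B)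
   = normal_prob (wmean (k :: L)) (wsd (k :: L)) A * P (event t B))%E.
Proof.
elim: L k t A B => [|l L IH] k t A B ut mB mA.
  have -> : wsum [:: k] @^-1` A = X k @^-1` ((fun x => c k * x + 0) @^-1` A).
    by apply/seteqP; split => w /=; rewrite /wsum big_seq1 addr0.
  rewrite (event_consM ut (scaled_event k mA) mB) (scaled_law k mA).
  rewrite /wmean /wsd !big_seq1 sqrtr_sqr.
  by rewrite (normal_prob_sd_norm _ (c k * s k)).
have mE := measurable_event t mB.
(* The probability of the remaining event, as a scaling factor: under [P] restricted to that event,
   the pair [(cX, wsum (l :: L))] has as law a product of a normal law and [r] times a normal
   law. *)
pose r := NngNum (fine_ge0 (measure_ge0 P (event t B))).
pose cX w : R := c k * X k w + 0.
have mcX : measurable_fun setT cX.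
  apply: (measurableT_comp (measurable_affine (c k) 0)).
  exact: measurable_funPT.
(* Moving [k] to the remaining variables lets the induction hypothesis for [l :: L] carry the event
   on [X k] along. *)
have utk : uniq ((l :: L) ++ k :: t).
  by rewrite -[k :: t]cat1s uniq_catCA.
have wmean_cons : wmean (k :: l :: L) = c k * m k + wmean (l :: L).
  by rewrite /wmean big_cons.
have wsd_cons : wsd (k :: l :: L)
    = Num.sqrt ((c k * s k) ^+ 2 + wsd (l :: L) ^+ 2).
  rewrite /wsd big_cons [in RHS]sqr_sqrtr// sumr_ge0// => ? _.
  exact: sqr_ge0.
have wsum_cons w : wsum (k :: l :: L) w = cX w + wsum (l :: L) w.
  by rewrite /wsum big_cons /cX addr0.
have -> : wsum (k :: l :: L) @^-1` A
  = (fun w => (cX w, wsum (l :: L) w)) @^-1` [set xy | A (xy.1 + xy.2)].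
  by apply/seteqP; split => w /=; rewrite wsum_cons.
have mC : measurable [set xy : R * R | A (xy.1 + xy.2)].
  rewrite -[X in measurable X]setTI.
  suff : measurable_fun setT (fun xy : R * R => xy.1 + xy.2) by apply.
  by apply: measurable_funD.
rewrite -[LHS]/(mrestr P mE _).
rewrite (@pushforward_pair_product _ _ _ _ _ _ _ (mrestr P mE)
  (normal_prob (c k * m k) (c k * s k))
  (mscale r (normal_prob (wmean (l :: L)) (wsd (l :: L))))
  _ _ mcX (@measurable_wsum (l :: L)) _ _ mC); last first.
- move=> A1 A2 mA1 mA2.
  rewrite -[LHS]/(P ((cX @^-1` A1 `&` wsum (l :: L) @^-1` A2) `&` event t B)).
  rewrite [cX @^-1` A1 `&` _]setIC -setIA.
  rewrite -[cX @^-1` A1]/(X k @^-1` ((fun x => c k * x + 0) @^-1` A1)).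
  move: (utk); rewrite cat_uniq => /and3P[_ _ ukt].
  have /andP[kt _] := ukt.
  rewrite event_cons// IH// => [|h]; last first.
    by case: ifP => // _; exact: scaled_event.
  rewrite -event_cons// event_consM//; last exact: scaled_event.
  rewrite (scaled_law k mA1).
  rewrite -[X in (_ = _ * X)%E]/((fine (P (event t B)))%:E
    * normal_prob (wmean (l :: L)) (wsd (l :: L)) A2)%E.
  rewrite fineK ?fin_num_measure//.
  by rewrite muleCA; congr (_ * _)%E; rewrite muleC.
rewrite /product_measure1.
transitivity (\int[normal_prob (c k * m k) (c k * s k)]_x
   ((fine (P (event t B)))%:E * (normal_prob (wmean (l :: L)) (wsd (l :: L))
     \o xsection [set xy : R * R | A (xy.1 + xy.2)%R]) x))%E.
  exact: eq_integral.
rewrite ge0_integralZl//; last 2 first.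
- by apply: measurable_fun_xsection; exact: mC.
- by rewrite lee_fin fine_ge0.
rewrite /=.
under eq_integral => x _.
  have -> : xsection [set xy : R * R | A (xy.1 + xy.2)] x
      = (fun y => x + y) @^-1` A.
    by apply/seteqP; split => y; rewrite /xsection/= ?inE.
  over.
rewrite (fineK (fin_num_measure P _ mE)) muleC.
rewrite (normal_prob_convolution _ _ (mulf_neq0 (c0 k) (s0 k)) (wsd_neq0 l L) mA).
by rewrite -wmean_cons -wsd_cons.
Qed.

Lemma weighted_sum_normal L A : L != [::] -> uniq L -> measurable A ->
  P [set w | A (\sum_(k <- L) c k * X k w)]
  = normal_prob (\sum_(k <- L) c k * m k)
      (Num.sqrt (\sum_(k <- L) (c k * s k) ^+ 2)) A.
Proof.
case: L => // k L _ uL mA.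
have uL0 : uniq ((k :: L) ++ [::]) by rewrite cats0.
have := weighted_sum_event uL0 (fun=> @measurableT _ R) mA.
by rewrite /event bigcap_seq big_nil setIT probability_setT mule1; apply.
Qed.

End sum_of_independent_normals.

Lemma cvg_natr_inv (R : realType) :
  (fun n : nat => n%:R^-1 : R) @ \oo --> (0 : R).
Proof.
apply/gtr0_cvgV0; last exact: cvgr_idn.
by near=> n; rewrite ltr0n; near: n; exists 1%N.
Unshelve. all: end_near. Qed.

(** * Tail bounds and exponential decay rate of a normal law *)

Section normal_tail.
Context {R : realType}.
Implicit Types (dl s : R).
Notation lambda := (@lebesgue_measure R).

(** For [x >= 0] one has [(x + dl) ^ 2 >= x ^ 2 + dl ^ 2], so the density is at most the exponential
    factor times the centered density, whose integral is at most 1. *)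
Lemma normal_tail_le dl s : 0 <= dl -> s != 0 ->
  (normal_prob (- dl) s `[0%R, +oo[%classic
   <= (expR (- dl ^+ 2 / (s ^+ 2 *+ 2)))%:E)%E.
Proof.
move=> dl0 s0; set e := expR _.
have mpdf (m : R) : measurable_fun (`[0%R, +oo[%classic : set R) (fun x => (normal_pdf m s x)%:E).
  by apply/measurable_EFinP/measurable_funTS; exact: measurable_normal_pdf.
apply: (@le_trans _ _ (\int[lambda]_(x in `[0%R, +oo[%classic)
    (e * normal_pdf 0 s x)%:E)%E).
  apply: ge0_le_integral => //=.
  - by move=> x _; rewrite lee_fin normal_pdf_ge0.
  - exact: mpdf.
  - apply/measurable_EFinP/measurable_funTS; apply: measurable_funM => //.
    exact: measurable_normal_pdf.
  - move=> x; rewrite in_itv/= andbT => x0; rewrite lee_fin !normal_pdfE//.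
    rewrite mulrCA ler_wpM2l ?normal_peak_ge0// /normal_fun /e -expRD ler_expR.
    rewrite -mulrDl ler_wpM2r ?invr_ge0 ?mulrn_wge0 ?sqr_ge0//.
    have := mulr_ge0 x0 dl0; rewrite subr0 opprK; nra.
under eq_integral do rewrite EFinM.
rewrite ge0_integralZl//=; last 3 first.
- exact: mpdf.
- by move=> x _; rewrite lee_fin normal_pdf_ge0.
- by rewrite lee_fin expR_ge0.
rewrite -[leRHS]mule1 lee_wpmul2l ?lee_fin ?expR_ge0//.
exact: (@probability_le1 _ _ _ (normal_prob 0 s)).
Qed.

(** Only the interval from 0 to [s] is kept. There the density is at least its value at [s], and the
    length [s] cancels the deviation in the peak. *)
Lemma normal_tail_ge dl s : 0 <= dl -> 0 < s ->
  ((expR (- (dl + s) ^+ 2 / (s ^+ 2 *+ 2)) / Num.sqrt (pi *+ 2))%:E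
   <= normal_prob (- dl) s `[0%R, +oo[%classic)%E.
Proof.
move=> dl0 s0; have sn0 : s != 0 by rewrite gt_eqF.
set e := expR _.
apply: (@le_trans _ _ (\int[lambda]_(x in `[0%R, s]%classic)
    (normal_pdf (- dl) s x)%:E)%E); last first.
  apply: ge0_subset_integral => //=.
  - by apply/measurable_EFinP/measurable_funTS; exact: measurable_normal_pdf.
  - by move=> x _; rewrite lee_fin normal_pdf_ge0.
  - by move=> x /=; rewrite !in_itv/= andbT => /andP[].
apply: (@le_trans _ _ (\int[lambda]_(x in `[0%R, s]%classic)
    (normal_peak s * e)%:E)%E); last first.
  apply: ge0_le_integral => //=.
  - by move=> x _; rewrite lee_fin mulr_ge0 ?normal_peak_ge0 ?expR_ge0.
  - by apply/measurable_EFinP/measurable_funTS; exact: measurable_normal_pdf.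
  - move=> x; rewrite in_itv/= => /andP[x0 xs]; rewrite lee_fin !normal_pdfE//.
    rewrite ler_wpM2l ?normal_peak_ge0// /normal_fun /e ler_expR.
    rewrite ler_wpM2r ?invr_ge0 ?mulrn_wge0 ?sqr_ge0// opprK lerN2.
    by rewrite ler_sqr ?nnegrE ?addr_ge0 ?(ltW s0)// addrC lerD2l.
rewrite integral_cst//= lebesgue_measure_itv/= lte_fin s0 sube0 -EFinM lee_fin.
rewrite /normal_peak -mulrnAr sqrtrM ?sqr_ge0// sqrtr_sqr gtr0_norm//.
rewrite le_eqVlt; apply/orP; left; apply/eqP; field.
by rewrite gt_eqF// sqrtr_gt0 mulrn_wgt0// pi_gt0.
Qed.

(** Squeeze between the two tail bounds: [v n] tends to 0, so [dl + Num.sqrt (v n)] tends to [dl],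
    and the constant prefactor contributes only a term of order [1 / n]. *)
Lemma normal_tail_rate dl (v : nat -> R) (V : R) : 0 <= dl -> 0 < V ->
  (\forall n \near \oo, 0 < v n) ->
  (fun n => n%:R * v n) @ \oo --> V ->
  (fun n => n%:R^-1 *
     ln (fine (normal_prob (- dl) (Num.sqrt (v n)) `[0%R, +oo[%classic)))
    @ \oo --> - dl ^+ 2 / (V *+ 2).
Proof.
move=> dl0 V0 v0 nvV.
have V20 : V *+ 2 != 0 by rewrite gt_eqF// mulrn_wgt0.
have invn := @cvg_natr_inv R.
have vcvg : v @ \oo --> (0 : R).
  rewrite -[0](mulr0 V).
  apply: cvg_trans (cvgM nvV invn); apply: near_eq_cvg; near=> n.
  have n0 : n%:R != 0 :> R by rewrite pnatr_eq0 -lt0n; near: n; exists 1%N.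
  by rewrite /GRing.mul_fun mulrAC divff// mul1r.
have svcvg : (fun n => Num.sqrt (v n)) @ \oo --> (0 : R).
  rewrite -sqrtr0; apply: (@continuous_cvg _ _ _ _ _ _ _ _ _ vcvg).
  exact: sqrt_continuous.
have ubcvg : (fun n => - dl ^+ 2 / ((n%:R * v n) *+ 2)) @ \oo
    --> - dl ^+ 2 / (V *+ 2).
  apply: cvgM; first exact: cvg_cst.
  apply: cvgV => //; exact: cvgMn.
have lbcvg : (fun n => - (dl + Num.sqrt (v n)) ^+ 2 / ((n%:R * v n) *+ 2)
     - n%:R^-1 * ln (Num.sqrt (pi *+ 2))) @ \oo --> - dl ^+ 2 / (V *+ 2).
  rewrite -[X in _ --> X]subr0 -[X in _ - X](mul0r (ln (Num.sqrt (pi *+ 2)))).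
  apply: cvgB; last by apply: cvgM => //; exact: cvg_cst.
  apply: cvgM; last by apply: cvgV => //; exact: cvgMn.
  rewrite -{2}[dl]addr0; apply: cvgN.
  by under [X in X @ _ --> _]eq_fun do rewrite expr2; apply: cvgM;
    apply: cvgD => //; exact: cvg_cst.
apply: squeeze_cvgr lbcvg ubcvg; near=> n.
have n0 : 0 < n%:R :> R by rewrite ltr0n; near: n; exists 1%N.
have vn0 : 0 < v n by near: n.
have s0 : 0 < Num.sqrt (v n) by rewrite sqrtr_gt0.
have s2 : Num.sqrt (v n) ^+ 2 = v n by rewrite sqr_sqrtr// ltW.
have sp0 : 0 < Num.sqrt (pi *+ 2) :> R by rewrite sqrtr_gt0 mulrn_wgt0// pi_gt0.
set p := fine _.
have pE : normal_prob (- dl) (Num.sqrt (v n)) `[0%R, +oo[%classic = p%:E.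
  by rewrite fineK// fin_num_measure.
have := normal_tail_ge dl0 s0; have := normal_tail_le dl0 (lt0r_neq0 s0).
rewrite pE !lee_fin s2 => ub lb.
have p0 : 0 < p by apply: lt_le_trans lb; rewrite divr_gt0 ?expR_gt0.
have -> : - dl ^+ 2 / (n%:R * v n *+ 2) = n%:R^-1 * (- dl ^+ 2 / (v n *+ 2)).
  by field; rewrite !gt_eqF.
have -> : - (dl + Num.sqrt (v n)) ^+ 2 / (n%:R * v n *+ 2)
   = n%:R^-1 * (- (dl + Num.sqrt (v n)) ^+ 2 / (v n *+ 2)).
  by field; rewrite !gt_eqF.
rewrite -mulrBr !ler_pM2l ?invr_gt0//; apply/andP; split.
  rewrite -[X in X - _]expRK -ln_div ?posrE ?expR_gt0//.
  by rewrite ler_ln ?posrE// divr_gt0 ?expR_gt0.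
by rewrite -[leRHS]expRK ler_ln ?posrE ?expR_gt0.
Unshelve. all: end_near. Qed.

End normal_tail.

(** * The rate function *)

(** Rounding down costs at most [1 / n]. *)
Lemma cvg_truncn (R : realType) (a : R) : 0 < a ->
  (fun n => (Num.truncn (a * n%:R))%:R / n%:R : R) @ \oo --> a.
Proof.
move=> a0.
have invn := @cvg_natr_inv R.
have lb : (fun n : nat => a - n%:R^-1) @ \oo --> a.
  by rewrite -[X in _ --> X]subr0; apply: cvgB => //; exact: cvg_cst.
apply: squeeze_cvgr lb (cvg_cst a); near=> n.
have n0 : 0 < n%:R :> R by rewrite ltr0n; near: n; exists 1%N.
have /truncn_itv/andP[h1 h2] : 0 <= a * n%:R by rewrite mulr_ge0// ltW.
rewrite ler_pdivrMr// h1 andbT ler_pdivlMr// mulrBl mulVf ?gt_eqF//.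
by rewrite lerBlDr -natr1 in h2 *; rewrite ltW.
Unshelve. all: end_near. Qed.

(** At a vector of replication counts this is the variance of the empirical mean of design [i]; at a
    vector of budget fractions it is [n] times that variance, up to rounding. *)
Definition variance_sum (R : realType) (K D : nat) (p : 'I_D -> R)
    (sigma : 'I_K -> 'I_D -> R) (i : 'I_K) (a : 'rV[R]_D) : R :=
  \sum_(j < D) sigma i j ^+ 2 * p j ^+ 2 / a 0 j.

Section gaussian_rate.
Context (R : realType) (d : measure_display) (T : measurableType d)
  (P : probability T R) (K D : nat) (D0 : (0 < D)%N).
Context (p : 'I_D -> R) (p0 : forall j, 0 < p j).
Context (mu sigma : 'I_K -> 'I_D -> R) (sigma0 : forall i j, 0 < sigma i j).
Context (X : 'I_K -> 'I_D -> nat -> {RV P >-> R}).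
Hypothesis hX : gaussian_outputs mu sigma X.
Context (b i : 'I_K).
Hypothesis ib : i != b.
Implicit Types (ab ai : 'rV[R]_D).

Let samples (N : 'I_K -> 'I_D -> nat) (l : 'I_K) : seq ('I_K * 'I_D * nat) :=
  [seq (l, j, s) | j <- index_enum 'I_D, s <- index_iota 0 (N l j)].

Let sum_samples N l (F : 'I_K * 'I_D * nat -> R) :
  \sum_(k <- samples N l) F k = \sum_(j < D) \sum_(s < N l j) F (l, j, val s).
Proof.
rewrite big_allpairs_dep; apply: eq_bigr => j _.
by rewrite big_mkord.
Qed.

Let uniq_samples N : uniq (samples N b ++ samples N i).
Proof.
have us l : uniq (samples N l).
  apply: allpairs_uniq_dep; first exact: index_enum_uniq.
    by move=> j _; exact: iota_uniq.
  by move=> [j s] [j' s'] _ _ /= [-> ->].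
rewrite cat_uniq !us andbT; apply/hasPn => k /allpairsPdep[j [s [_ _ ->]]].
apply/negP => /allpairsPdep[j' [s' [_ _ [/eqP]]]].
by rewrite (negbTE ib).
Qed.

Let empirical (N : 'I_K -> 'I_D -> nat) (l : 'I_K) w : R :=
  \sum_(j < D) p j * ((N l j)%:R^-1 * \sum_(s < N l j) X l j s w).

(** The event says that the mean of [i] minus the mean of [b] is nonnegative. This difference is a
    weighted sum of independent normal samples, with expectation minus the gap. *)
Let error_probability N : (forall l j, (0 < N l j)%N) ->
  P [set w | empirical N b w <= empirical N i w]
  = normal_prob (- (mean p mu b - mean p mu i))
      (Num.sqrt (variance_sum p sigma b (\row_j (N b j)%:R)
                 + variance_sum p sigma i (\row_j (N i j)%:R)))
      `[0%R, +oo[%classic.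
Proof.
move=> N0; have [Xn Xind] := hX.
have N1 l j : (N l j)%:R != 0 :> R by rewrite pnatr_eq0 -lt0n.
(* Weights of the difference of the two empirical means. They are nonzero at every index, as
   [weighted_sum_normal] requires, but only samples of [b] and [i] are summed. *)
pose c (k : 'I_K * 'I_D * nat) : R :=
  (if k.1.1 == i then 1 else - 1) * (p k.1.2 / (N k.1.1 k.1.2)%:R).
have c0 k : c k != 0.
  rewrite /c !mulf_neq0 ?invr_eq0//; last by rewrite gt_eqF.
  by case: ifP => _; rewrite ?oppr_eq0 oner_eq0.
have cb j s : c (b, j, s) = - (p j / (N b j)%:R).
  by rewrite /c/= eq_sym (negbTE ib) mulN1r.
have ci j s : c (i, j, s) = p j / (N i j)%:R by rewrite /c/= eqxx mul1r.
have sn0 (k : 'I_K * 'I_D * nat) : sigma k.1.1 k.1.2 != 0 by rewrite gt_eqF.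
have Xn' (k : 'I_K * 'I_D * nat) (B : set R) : measurable B ->
  distribution P (X k.1.1 k.1.2 k.2) B
  = normal_prob (mu k.1.1 k.1.2) (sigma k.1.1 k.1.2) B by exact: Xn.
have LN : samples N b ++ samples N i != [::].
  have : (b, Ordinal D0, 0%N) \in samples N b ++ samples N i.
    rewrite mem_cat; apply/orP; left; apply/allpairsPdep.
    exists (Ordinal D0), 0%N; rewrite mem_index_enum mem_index_iota N0.
    by split.
  by case: (_ ++ _).
have := weighted_sum_normal Xind Xn' sn0 c0 LN (uniq_samples N)
  (measurable_itv `[0%R, +oo[).
rewrite !big_cat/= !sum_samples/=.
have -> : \sum_(j < D) \sum_(s < N b j) c (b, j, val s) * mu b j
   + \sum_(j < D) \sum_(s < N i j) c (i, j, val s) * mu i j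
   = - (mean p mu b - mean p mu i).
  rewrite opprB addrC /mean -sumrN; congr (_ + _); apply: eq_bigr => j _.
    under eq_bigr do rewrite ci.
    by rewrite sumr_const card_ord -mulr_natr; field.
  under eq_bigr do rewrite cb.
  by rewrite sumr_const card_ord -mulr_natr; field.
have -> : \sum_(j < D) \sum_(s < N b j) (c (b, j, val s) * sigma b j) ^+ 2
   + \sum_(j < D) \sum_(s < N i j) (c (i, j, val s) * sigma i j) ^+ 2
   = variance_sum p sigma b (\row_j (N b j)%:R)
     + variance_sum p sigma i (\row_j (N i j)%:R).
  rewrite /variance_sum; congr (_ + _); apply: eq_bigr => j _; rewrite mxE.
    under eq_bigr do rewrite cb.
    by rewrite sumr_const card_ord -mulr_natr; field.
  under eq_bigr do rewrite ci.
  by rewrite sumr_const card_ord -mulr_natr; field.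
move=> <-; congr (P _); apply/funext => w /=; apply/propext.
rewrite big_cat/= !sum_samples/= in_itv/= andbT.
have -> : \sum_(j < D) \sum_(s < N b j) c (b, j, val s) * X b j s w
   = - empirical N b w.
  rewrite /empirical -sumrN; apply: eq_bigr => j _.
  by rewrite mulrA -mulNr mulr_sumr; apply: eq_bigr => s _; rewrite cb.
have -> : \sum_(j < D) \sum_(s < N i j) c (i, j, val s) * X i j s w
   = empirical N i w.
  rewrite /empirical; apply: eq_bigr => j _.
  by rewrite mulrA mulr_sumr; apply: eq_bigr => s _; rewrite ci.
by rewrite addrC subr_ge0.
Qed.

Lemma variance_sum_gt0 l (a : 'rV[R]_D) : (forall j, 0 < a 0 j) ->
  0 < variance_sum p sigma l a.
Proof.
move=> a0; rewrite /variance_sum (bigD1 (Ordinal D0))//= ltr_wpDr//.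
  by apply: sumr_ge0 => j _; rewrite divr_ge0 ?mulr_ge0 ?sqr_ge0// ltW.
by rewrite divr_gt0 ?mulr_gt0 ?exprn_gt0.
Qed.

(** For large [n] the error probability is a normal tail with variance [v n] computed from the
    rounded counts, and [n * v n] tends to [V]. *)
Lemma G_gaussian ab ai : mean p mu i <= mean p mu b ->
  (forall j, 0 < ab 0 j) -> (forall j, 0 < ai 0 j) ->
  G p X b i ab ai = (mean p mu b - mean p mu i) ^+ 2
    / ((variance_sum p sigma b ab + variance_sum p sigma i ai) *+ 2).
Proof.
move=> mub ab0 ai0.
rewrite /G ifT; last by apply/forallP => j; rewrite ab0 ai0.
set V := variance_sum p sigma b ab + _.
have V0 : 0 < V by rewrite addr_gt0 ?variance_sum_gt0.
(* The counts in [error_probability] are indexed by all designs; any design other than [i] is given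
   the positive row [ab]. *)
pose a l : 'rV[R]_D := if l == i then ai else ab.
have a0 l j : 0 < a l 0 j by rewrite /a; case: ifP.
have abE : a b = ab by rewrite /a eq_sym (negbTE ib).
have aiE : a i = ai by rewrite /a eqxx.
pose N n l j := Num.truncn (a l 0 j * n%:R).
have Ncvg l j : (fun n => (N n l j)%:R / n%:R : R) @ \oo --> a l 0 j.
  exact: cvg_truncn.
pose v n := variance_sum p sigma b (\row_j (N n b j)%:R)
   + variance_sum p sigma i (\row_j (N n i j)%:R).
(* Rounded counts may vanish for small [n], but all are positive once [n] is large. *)
have Npos : \forall n \near \oo, forall l j, (0 < N n l j)%N.
  suff : \forall n \near \oo, forall lj : 'I_K * 'I_D, (0 < N n lj.1 lj.2)%N.
    by apply: filterS => n Nn l j; exact: (Nn (l, j)).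
  apply: filter_forall => -[l j] /=.
  have : \forall n \near \oo, 0 < (N n l j)%:R / n%:R :> R.
    exact: cvgr_gt (Ncvg l j) _ (a0 l j).
  by apply: filterS => n; case: (N n l j) => //; rewrite mul0r ltxx.
have v0 : \forall n \near \oo, 0 < v n.
  near=> n; have Nn : forall l j, (0 < N n l j)%N by near: n.
  by rewrite addr_gt0// variance_sum_gt0// => j; rewrite mxE ltr0n.
have nvar l : (fun n => n%:R * variance_sum p sigma l (\row_j (N n l j)%:R))
    @ \oo --> variance_sum p sigma l (a l).
  rewrite /variance_sum; under eq_fun do rewrite mulr_sumr.
  apply: cvg_big => [|j _]; first exact: add_continuous.
  under eq_fun do rewrite mxE mulrCA -[n in n / _]invrK -invfM [_ ^-1 * _]mulrC.
  apply: cvgM; first exact: cvg_cst.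
  by apply: cvgV; [rewrite gt_eqF | exact: Ncvg].
have nv : (fun n => n%:R * v n) @ \oo --> V.
  rewrite /V -abE -aiE; under eq_fun do rewrite mulrDr.
  exact: cvgD.
have := normal_tail_rate (dl := mean p mu b - mean p mu i) _ V0 v0 nv.
rewrite subr_ge0 => /(_ mub) rate.
rewrite -[RHS]opprK -mulNr; congr (- _); apply/cvg_lim => //.
apply: cvg_trans rate; apply: near_eq_cvg; near=> n.
have Nn : forall l j, (0 < N n l j)%N by near: n.
by rewrite -error_probability// /empirical /mu_hat /N abE aiE.
Unshelve. all: end_near. Qed.

End gaussian_rate.

(** * Directional derivatives of the rate *)

Section directional_derivatives.
Context (R : realType) (D : nat).
Implicit Types (f : 'rV[R]_D -> R) (a v : 'rV[R]_D) (k c u W : R).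

(** The derivative is in particular the left limit of difference quotients that are all 0. This
    rules out a nonzero derivative where an allocation component vanishes. *)
Lemma derive_left_constant f a v : derivable f a v ->
  (forall h, h < 0 -> f (h *: v + a) = f a) -> 'D_v f a = 0.
Proof.
move=> df fa; pose q (h : R) : R := h^-1 *: ((f \o shift a) (h *: v) - f a).
have qD : q h @[h --> 0^'-] --> ('D_v f a : R).
  by apply: cvg_dnbhs_at_left; exact: df.
have q0 : q h @[h --> 0^'-] --> (0 : R).
  apply: cvg_near_cst; near=> h.
  by rewrite /q/= fa ?subrr ?scaler0//; near: h; exact: nbhs_left_lt.
exact: cvg_unique qD q0.
Unshelve. all: end_near. Qed.

Lemma derive_inverse_affine f a v k c u W : 0 < u -> 0 < W ->
  (\forall h \near 0, f (h *: v + a) = k / ((W + (c / (u + h) - c / u)) *+ 2)) ->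
  derivable f a v /\ 'D_v f a = k * c / (u ^+ 2 * W ^+ 2 *+ 2).
Proof.
move=> u0 W0 fE.
have f0 : f a = k / (W *+ 2).
  by have := nbhs_singleton fE; rewrite scale0r add0r addr0 subrr addr0.
(* For small nonzero [h] the difference quotient simplifies to [k * c / den h], where the factor [h]
   has cancelled and [den] is continuous at 0. *)
pose den (h : R) := (W * u * (u + h) - c * h) * W *+ 2.
have denc : den h @[h --> (0 : R)] --> den 0.
  apply: cvgMn; apply: cvgM; last exact: cvg_cst.
  apply: cvgB; apply: cvgM; try exact: cvg_cst; last exact: cvg_id.
  by apply: cvgD; [exact: cvg_cst | exact: cvg_id].
have den0 : 0 < den 0.
  by rewrite /den mulr0 subr0 addr0 mulrn_wgt0// !mulr_gt0.
have uc : u + h @[h --> (0 : R)] --> u.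
  by rewrite -[X in _ --> X]addr0; apply: cvgD; [exact: cvg_cst | exact: cvg_id].
have qE : \forall h \near 0^', k * c / den h
    = h^-1 *: ((f \o shift a) (h *: v) - f a).
  near=> h; have h0 : h != 0 by near: h; exact: nbhs_dnbhs_neq.
  have fh : f (h *: v + a) = k / ((W + (c / (u + h) - c / u)) *+ 2).
    near: h; exact: cvg_within fE.
  have uh : 0 < u + h.
    near: h; apply: cvg_within; exact: cvgr_gt uc _ u0.
  have dh : 0 < den h.
    by near: h; apply: cvg_within; exact: cvgr_gt denc _ den0.
  rewrite /= fh f0 /den /GRing.scale/=.
  have d1 : (W * u * (u + h) - c * h) != 0.
    by apply: contraTneq dh => e; rewrite /den e mul0r mul0rn ltxx.
  have d2 : W * u * (u + h) - c * h = (W + (c / (u + h) - c / u)) * (u * (u + h)).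
    by field; rewrite !gt_eqF.
  have d3 : W + (c / (u + h) - c / u) != 0.
    by apply: contraNneq d1 => e; rewrite d2 e mul0r.
  have -> : W + (c / (u + h) - c / u) = (W * u * (u + h) - c * h) / (u * (u + h)).
    by rewrite d2 mulfK// mulf_neq0 ?gt_eqF.
  field; by rewrite d1 h0 !gt_eqF.
have qcvg : h^-1 *: ((f \o shift a) (h *: v) - f a) @[h --> 0^'] --> k * c / den 0.
  apply: cvg_trans; first exact: near_eq_cvg qE.
  apply: cvg_within_filter; apply: cvgM; first exact: cvg_cst.
  by apply: cvgV => //; rewrite gt_eqF.
have -> : u ^+ 2 * W ^+ 2 *+ 2 = den 0 by rewrite /den; ring.
split; first by apply/cvg_ex; exists (k * c / den 0).
exact: cvg_lim qcvg.
Unshelve. all: end_near. Qed.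

Lemma variance_sum_shift K (p : 'I_D -> R) (sigma : 'I_K -> 'I_D -> R) l a j h :
  variance_sum p sigma l (h *: delta_mx 0 j + a) = variance_sum p sigma l a
  + (sigma l j ^+ 2 * p j ^+ 2 / (a 0 j + h) - sigma l j ^+ 2 * p j ^+ 2 / a 0 j).
Proof.
rewrite /variance_sum (bigD1 j)//= [in RHS](bigD1 j)//=.
rewrite !mxE !eqxx mulr1 [h + _]addrC.
under eq_bigr => j' j'j do rewrite !mxE (negbTE j'j) mulr0 add0r.
ring.
Qed.

Lemma shift_gt0 a j : (forall j', 0 < a 0 j') ->
  \forall h \near (0 : R), forall j', 0 < (h *: delta_mx 0 j + a) 0 j'.
Proof.
move=> a0.
have c : h + a 0 j @[h --> (0 : R)] --> a 0 j.
  by rewrite -[X in _ --> X]add0r; apply: cvgD; [exact: cvg_id | exact: cvg_cst].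
have : \forall h \near (0 : R), 0 < h + a 0 j by exact: cvgr_gt c _ (a0 j).
apply: filterS => h ha j'; rewrite !mxE eqxx/=.
by case: (eqVneq j' j) => [->|_]; rewrite ?mulr1 ?mulr0 ?add0r.
Qed.

End directional_derivatives.

(** * Balanced allocations *)

Section balance.
Context (R : realType) (K D : nat) (K2 : (2 <= K)%N) (D0 : (0 < D)%N).
Context (p : 'I_D -> R) (p0 : forall j, 0 < p j).
Context (mu sigma : 'I_K -> 'I_D -> R) (sigma0 : forall i j, 0 < sigma i j).
Context (b : 'I_K) (hb : forall i, i != b -> mean p mu i < mean p mu b).
Context (g : 'I_K -> 'rV[R]_D -> 'rV[R]_D -> R).
Implicit Types (ab ai : 'rV[R]_D) (al : 'M[R]_(K, D)) (x : 'I_K -> R) (z : R).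

Let gap i := mean p mu b - mean p mu i.
Let var l a := variance_sum p sigma l a.

(** The rate function enters this section only through these two properties, which the final theorem
    verifies for [G]. *)
Hypothesis g_gt0 : forall i ab ai, i != b ->
  (forall j, 0 < ab 0 j) -> (forall j, 0 < ai 0 j) ->
  g i ab ai = gap i ^+ 2 / ((var b ab + var i ai) *+ 2).
Hypothesis g_le0 : forall i ab ai j,
  (ab 0 j <= 0) || (ai 0 j <= 0) -> g i ab ai = 0.

Let gap_gt0 i : i != b -> 0 < gap i.
Proof. by move=> ib; rewrite subr_gt0 hb. Qed.

Let j0 := Ordinal D0.

Let exists_neq_b : exists i, i != b.
Proof.
pose i0 : 'I_K := Ordinal (ltnW K2); pose i1 : 'I_K := Ordinal K2.
have [e|] := eqVneq b i0; first by exists i1; rewrite e.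
by rewrite eq_sym; exists i0.
Qed.

(* [x l] is the common value of [al l j / (sigma l j * p j)] over [j]. *)
Definition balanced al x z : Prop :=
  [/\ forall l, 0 < x l, forall l j, al l j = sigma l j * p j * x l,
      x b ^+ 2 = \sum_(i < K | i != b) x i ^+ 2 &
      forall i, i != b -> g i (row b al) (row i al) = z].

(** * A balanced allocation is the unique optimum *)

Lemma balanced_gt0 al x z : balanced al x z -> forall l j, 0 < al l j.
Proof. by case=> x0 alE _ _ l j; rewrite alE !mulr_gt0. Qed.

Lemma var_gt0 l ai : (forall j, 0 < ai 0 j) -> 0 < var l ai.
Proof. exact: variance_sum_gt0. Qed.

Lemma g_row al i : i != b -> (forall l j, 0 < al l j) ->
  g i (row b al) (row i al) = gap i ^+ 2 / ((var b (row b al) + var i (row i al)) *+ 2).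
Proof. by move=> ib al0; rewrite g_gt0// => j; rewrite mxE. Qed.

(* With [al l j = sigma l j * p j * x l], the tangent of [c / a] at [al l j],
   [c = sigma l j ^+ 2 * p j ^+ 2], has slope [- 1 / x l ^+ 2], the same for all [j]. *)
Let excess al x al' l : R := \sum_(j < D)
  (sigma l j ^+ 2 * p j ^+ 2 / al' l j - sigma l j ^+ 2 * p j ^+ 2 / al l j
   + (al' l j - al l j) / x l ^+ 2).

(** At [a = al l j] the constant [c] equals [a ^ 2 / x l ^ 2], so the gap above the tangent is a
    perfect square over a positive number, zero only at [al' l j = al l j]. *)
Let excess_term al x z al' l j : balanced al x z -> 0 < al' l j ->
  sigma l j ^+ 2 * p j ^+ 2 / al' l j - sigma l j ^+ 2 * p j ^+ 2 / al l j
   + (al' l j - al l j) / x l ^+ 2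
  = (al' l j - al l j) ^+ 2 / (x l ^+ 2 * al' l j).
Proof.
case=> x0 alE _ _ a0; rewrite alE; field.
by rewrite !gt_eqF.
Qed.

Let excess_ge0 al x z al' l : balanced al x z -> (forall l j, 0 < al' l j) ->
  0 <= excess al x al' l.
Proof.
move=> bal a0; apply: sumr_ge0 => j _; rewrite (excess_term bal)//.
by have [x0 _ _ _] := bal; rewrite divr_ge0 ?sqr_ge0 ?mulr_ge0 ?sqr_ge0 ?ltW.
Qed.

Let excess_eq0 al x z al' l : balanced al x z -> (forall l j, 0 < al' l j) ->
  excess al x al' l = 0 -> forall j, al' l j = al l j.
Proof.
move=> bal a0 /eqP; rewrite psumr_eq0 => [/allP h j|j _]; last first.
  rewrite (excess_term bal)//.
  by have [x0 _ _ _] := bal; rewrite divr_ge0 ?sqr_ge0 ?mulr_ge0 ?sqr_ge0 ?ltW.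
have := h j (mem_index_enum j); rewrite (excess_term bal)//= mulf_eq0 invr_eq0.
have [x0 _ _ _] := bal.
rewrite [X in _ || X]gt_eqF ?mulr_gt0 ?exprn_gt0// orbF sqrf_eq0 subr_eq0.
by move/eqP.
Qed.

(** Because the slope does not depend on [j], the linear part involves only the total budget of
    design [l]. *)
Let excessE al x al' l : excess al x al' l
  = var l (row l al') - var l (row l al)
    + (\sum_(j < D) al' l j - \sum_(j < D) al l j) / x l ^+ 2.
Proof.
rewrite /excess big_split/= -mulr_suml !sumrB; congr (_ - _ + _);
by apply: eq_bigr => j _; rewrite mxE.
Qed.

(** The rigidity from which both optimality and uniqueness follow. *)
Lemma balanced_max al x z al' : allocation al -> balanced al x z ->
  allocation al' -> (forall i, i != b -> z <= g i (row b al') (row i al')) ->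
  al' = al.
Proof.
move=> [_ sum1] bal [_ sum1'] zle.
have [x0 alE xb gz] := bal.
have al0 := balanced_gt0 bal.
have [i1 i1b] := exists_neq_b.
have z0 : 0 < z.
  rewrite -(gz _ i1b) g_row// divr_gt0 ?exprn_gt0 ?gap_gt0//.
  by rewrite mulrn_wgt0// addr_gt0// var_gt0// => j; rewrite mxE.
(* A component of [al'] that is not positive would make some rate 0, below [z > 0]. *)
have al'0 l j : 0 < al' l j.
  have pos i : i != b -> 0 < al' b j /\ 0 < al' i j.
    move=> ib; apply/andP; apply: contraLR (lt_le_trans z0 (zle i ib)).
    rewrite negb_and -!leNgt => h.
    by rewrite (@g_le0 _ _ _ j) ?ltxx// !mxE.
  have [->|lb] := eqVneq l b; first exact: (pos _ i1b).1.
  exact: (pos _ lb).2.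
have varle i : i != b ->
    var b (row b al') + var i (row i al') <= var b (row b al) + var i (row i al).
  move=> ib; have := zle i ib; rewrite -(gz i ib) !g_row//.
  have V0 (a : 'M[R]_(K, D)) : (forall l j, 0 < a l j) -> 0 < (var b (row b a) + var i (row i a)) *+ 2.
    by move=> a0; rewrite mulrn_wgt0// addr_gt0// var_gt0// => j; rewrite mxE.
  rewrite ler_pM2l ?exprn_gt0 ?gap_gt0// lef_pV2 ?posrE ?V0//.
  by rewrite lerMn2r.
pose m l := \sum_(j < D) al' l j - \sum_(j < D) al l j.
have m0 : \sum_(l < K) m l = 0 by rewrite sumrB sum1 sum1' subrr.
(* The variance inequality for the pair [b], [i], with tangent terms added and multiplied by
   [x i ^ 2]; [m] records changes of design budgets. *)
have key i : i != b ->
    x i ^+ 2 * excess al x al' b + x i ^+ 2 * excess al x al' i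
    <= x i ^+ 2 / x b ^+ 2 * m b + m i.
  move=> ib; have := varle i ib; rewrite !excessE -/(m b) -/(m i) => h.
  rewrite -mulrDr -ler_pdivlMl ?exprn_gt0// mulrDr mulrA.
  have -> : (x i ^+ 2)^-1 * (x i ^+ 2 / x b ^+ 2) = (x b ^+ 2)^-1.
    by field; rewrite !gt_eqF.
  rewrite [_^-1 * m b]mulrC [_^-1 * m i]mulrC; lra.
(* Summed over [i != b], the weights [x i ^ 2] add up to [x b ^ 2], so the right-hand sides add up
   to the change of the whole budget, which is 0. *)
have total : \sum_(l < K) x l ^+ 2 * excess al x al' l <= 0.
  have : \sum_(i < K | i != b)
      (x i ^+ 2 * excess al x al' b + x i ^+ 2 * excess al x al' i)
    <= \sum_(i < K | i != b) (x i ^+ 2 / x b ^+ 2 * m b + m i) by exact: ler_sum.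
  rewrite big_split [X in _ <= X]big_split/= -!mulr_suml -xb divff ?gt_eqF ?exprn_gt0// mul1r.
  have -> : m b + \sum_(i < K | i != b) m i = \sum_(l < K) m l.
    by rewrite [RHS](bigD1 b).
  by rewrite m0 [X in _ -> X <= _](bigD1 b).
have term0 l : 0 <= x l ^+ 2 * excess al x al' l.
  by rewrite mulr_ge0 ?sqr_ge0// (excess_ge0 _ bal).
have all0 : \sum_(l < K) x l ^+ 2 * excess al x al' l = 0.
  by apply/eqP; rewrite eq_le total sumr_ge0.
apply/matrixP => l; apply: (excess_eq0 bal) => //.
move/eqP: all0; rewrite psumr_eq0// => /allP /(_ l (mem_index_enum l)).
by rewrite /= mulf_eq0 sqrf_eq0 gt_eqF//= => /eqP.
Qed.

Lemma balanced_feasible al x z : allocation al -> balanced al x z ->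
  feasible g b al z.
Proof.
by move=> aal [_ _ _ gz]; split=> // i ib; rewrite gz// subrr.
Qed.

(** A feasible allocation of value above [z] would be [al] itself by [balanced_max], but the rates
    of [al] equal [z]. *)
Lemma balanced_optimal al x z : allocation al -> balanced al x z ->
  optimal g b al.
Proof.
move=> aal bal; exists z; split; first exact: balanced_feasible bal.
move=> al' z' [fz' aal']; rewrite leNgt; apply/negP => zz'.
have gz' i : i != b -> z' <= g i (row b al') (row i al').
  by move=> ib; rewrite -subr_ge0 fz'.
have e : al' = al.
  apply: (balanced_max aal bal aal') => i ib.
  by rewrite (le_trans (ltW zz'))// gz'.
have [i1 i1b] := exists_neq_b; have [_ _ _ gz] := bal.
by move: (gz' _ i1b); rewrite e gz// leNgt zz'.
Qed.

Lemma optimal_unique al x z al' : allocation al -> balanced al x z ->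
  optimal g b al' -> al' = al.
Proof.
move=> aal bal [z' [[fz' aal'] opt]].
apply: (balanced_max aal bal aal') => i ib.
rewrite (le_trans (opt _ _ (balanced_feasible aal bal)))//.
by rewrite -subr_ge0 fz'.
Qed.

(** * Existence of a balanced allocation *)

Let weight l : R := \sum_(j < D) sigma l j * p j.

Let weight_gt0 l : 0 < weight l.
Proof.
rewrite /weight (bigD1 j0)//= ltr_wpDr ?mulr_gt0//.
by apply: sumr_ge0 => j _; rewrite mulr_ge0// ltW.
Qed.

(** For such a proportional row, [weight l] governs both the variance, [weight l / c], and the
    budget, [weight l * c]. *)
Let var_proportional l ai c : 0 < c ->
  (forall j, ai 0 j = sigma l j * p j * c) -> var l ai = weight l / c.
Proof.
move=> c0 aE; rewrite /var /variance_sum /weight mulr_suml.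
by apply: eq_bigr => j _; rewrite aE; field; rewrite !gt_eqF.
Qed.

(** Here [t] is twice the common rate of the allocation with proportions [y], not yet normalized to
    total budget 1. *)
Lemma exists_proportions : exists (y : 'I_K -> R) (t : R),
  [/\ 0 < t, forall l, 0 < y l, y b = 1, \sum_(i < K | i != b) y i ^+ 2 = 1 &
      forall i, i != b -> weight b + weight i / y i = gap i ^+ 2 / t].
Proof.
have [i1 i1b] := exists_neq_b.
have [m mb mmin] : exists2 m, m != b & forall i, i != b -> gap m <= gap i.
  by case: (@arg_minP _ _ _ i1 (fun i => i != b) gap i1b) => m mb mmin; exists m.
(* At [t1] the design [m] of smallest gap gets proportion 1, so the sum of squares is at least 1
   there; up to [t1] all denominators stay positive. *)
pose t1 := gap m ^+ 2 / (weight b + weight m).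
have t10 : 0 < t1 by rewrite divr_gt0 ?exprn_gt0 ?gap_gt0// addr_gt0.
have den0 i t : i != b -> t <= t1 -> 0 < gap i ^+ 2 - weight b * t.
  move=> ib tt1; rewrite subr_gt0.
  apply: (@le_lt_trans _ _ (weight b * t1)); first by rewrite ler_pM2l.
  apply: (@lt_le_trans _ _ (gap m ^+ 2)); last first.
    by rewrite ler_sqr ?nnegrE ?(ltW (gap_gt0 _))// mmin.
  rewrite /t1 mulrCA gtr_pMr ?exprn_gt0 ?gap_gt0//.
  by rewrite ltr_pdivrMr ?addr_gt0// mul1r ltrDl.
pose y (t : R) i := weight i * t / (gap i ^+ 2 - weight b * t).
pose f (t : R) := \sum_(i < K | i != b) y t i ^+ 2.
have fcont : {within `[0, t1], continuous f}.
  apply: continuous_in_subspaceT => t; rewrite inE/= in_itv/= => /andP[_ tt1].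
  apply: cvg_big => [|i ib]; first exact: add_continuous.
  have yc : {for t, continuous (y ^~ i)}.
    apply: cvgM; first by apply: cvgM; [exact: cvg_cst|exact: cvg_id].
    apply: cvgV; first by rewrite gt_eqF ?den0.
    apply: cvgB; first exact: cvg_cst.
    by apply: cvgM; [exact: cvg_cst|exact: cvg_id].
  by under eq_fun do rewrite expr2; rewrite expr2; exact: cvgM.
have f0 : f 0 = 0 by apply: big1 => i _; rewrite /y mulr0 mul0r expr0n.
have ft1 : 1 <= f t1.
  rewrite /f (bigD1 m)//= (_ : y t1 m = 1); last first.
    rewrite /y.
    have -> : gap m ^+ 2 - weight b * t1 = weight m * t1.
      by rewrite /t1; field; rewrite gt_eqF// addr_gt0.
    by rewrite divff// gt_eqF// mulr_gt0.
  by rewrite expr1n lerDl sumr_ge0// => i _; exact: sqr_ge0.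
have [t] : exists2 t, t \in `[0, t1] & f t = 1.
  apply: (IVT (ltW t10) fcont).
  by rewrite f0 ge_min ler01/= le_max ft1 orbT.
rewrite in_itv/= => /andP[t0 tt1] ft.
have {}t0 : 0 < t.
  rewrite lt_neqAle t0 andbT; apply: contra_eq_neq ft => <-.
  by rewrite f0 eq_sym oner_eq0.
exists (fun l => if l == b then 1 else y t l), t; split => //.
- move=> l; case: eqVneq => // lb.
  by rewrite /y !mulr_gt0// invr_gt0 den0.
- by rewrite eqxx.
- by rewrite -[RHS]ft; apply: eq_bigr => i ib; rewrite (negbTE ib).
- move=> i ib; rewrite (negbTE ib) /y.
  have := den0 i t ib tt1 => d0.
  by field; rewrite !gt_eqF.
Qed.

Lemma exists_balanced : exists al x z, allocation al /\ balanced al x z.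
Proof.
have [y [t [t0 y0 yb ysum yt]]] := exists_proportions.
(* Total budget used by the proportions [y]. *)
pose N := \sum_(l < K) weight l * y l.
have N0 : 0 < N.
  rewrite /N (bigD1 b)//= ltr_wpDr ?mulr_gt0//.
  by apply: sumr_ge0 => i _; rewrite mulr_ge0// ltW.
pose x l := y l / N.
have x0 l : 0 < x l by rewrite divr_gt0.
pose al : 'M[R]_(K, D) := \matrix_(l, j) (sigma l j * p j * x l).
have alE l j : al l j = sigma l j * p j * x l by rewrite mxE.
have al0 l j : 0 < al l j by rewrite alE mulr_gt0// mulr_gt0.
(* Dividing the proportions by [N] multiplies variances by [N], hence turns the common rate [t / 2]
   into [t / (2 N)]. *)
exists al, x, (t / (N *+ 2)); split.
  split=> [l j|]; first exact: ltW.
  transitivity (\sum_(l < K) weight l * y l / N).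
    apply: eq_bigr => l _; rewrite -mulrA mulr_suml.
    by apply: eq_bigr => j _; rewrite alE.
  by rewrite -mulr_suml divff// gt_eqF.
split=> //.
  rewrite /x yb; under eq_bigr do rewrite exprMn.
  by rewrite -mulr_suml ysum exprMn expr1n.
have varE l : var l (row l al) = weight l / x l.
  by apply: var_proportional => // j; rewrite mxE alE.
move=> i ib; rewrite g_row// !varE.
have -> : weight b / x b + weight i / x i = N * (gap i ^+ 2 / t).
  rewrite -(yt i ib) /x yb; field; by rewrite !gt_eqF.
by field; rewrite !gt_eqF ?gap_gt0.
Qed.

(** * Equivalence with the explicit conditions *)

Let mean_variance_fin l al : (forall j, 0 < al l j) ->
  mean_variance p sigma l al = (var l (row l al))%:E.
Proof.
move=> al0; rewrite /mean_variance /var /variance_sum -sumEFin.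
by apply: eq_bigr => j _; rewrite inver gt_eqF// mxE -EFinM.
Qed.

Let mean_variance_pinfty l al : (forall j, al l j = 0) ->
  mean_variance p sigma l al = +oo%E.
Proof.
move=> al0; rewrite /mean_variance.
have termE j : ((sigma l j ^+ 2 * p j ^+ 2)%:E / (al l j)%:E)%E = +oo%E :> \bar R.
  by rewrite al0 inve0 gt0_muley// lte_fin mulr_gt0 ?exprn_gt0.
rewrite (bigD1 j0)//= termE addye// gt_eqF// (lt_le_trans ltNy0)// sume_ge0// => j _.
by rewrite termE.
Qed.

Let local_ratio al i : (forall j, 0 < al b j) -> (forall j, 0 < al i j) ->
  ((gap i ^+ 2)%:E / (mean_variance p sigma b al + mean_variance p sigma i al)
   = (gap i ^+ 2 / (var b (row b al) + var i (row i al)))%:E)%E.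
Proof.
move=> b0 i0; rewrite !mean_variance_fin// -EFinD inver gt_eqF -?EFinM//.
by rewrite addr_gt0// var_gt0// => j; rewrite mxE.
Qed.

Lemma balanced_explicit al x z : balanced al x z ->
  [/\ input_balance_explicit p sigma b al,
      total_balance_explicit sigma b al &
      local_balance_explicit p mu sigma b al].
Proof.
move=> bal; have al0 := balanced_gt0 bal; have [x0 alE xb gz] := bal; split.
- by move=> i j j' _; rewrite !alE; field; rewrite !gt_eqF.
- move=> j; transitivity (p j ^+ 2 * x b ^+ 2).
    by rewrite alE; field; rewrite gt_eqF.
  rewrite xb mulr_sumr; apply: eq_bigr => i _.
  by rewrite alE; field; rewrite gt_eqF.
- move=> i i' ib i'b _; rewrite -/(gap i) -/(gap i') !local_ratio//; congr EFin.
  have : g i (row b al) (row i al) = g i' (row b al) (row i' al) by rewrite !gz.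
  rewrite !g_row// -[(var _ _ + _) *+ 2]mulr_natr -[X in _ = _ / X]mulr_natr.
  rewrite !invfM !mulrA => /mulIf; apply.
  by rewrite invr_eq0 pnatr_eq0.
Qed.

(** Input balance gives proportionality for [i != b], and total balance transfers it to [b].
    Positivity comes last, from the total budget and from local balance with its conventions at
    infinity. *)
Lemma explicit_balanced al : allocation al ->
  [/\ input_balance_explicit p sigma b al,
      total_balance_explicit sigma b al &
      local_balance_explicit p mu sigma b al] ->
  exists x z, balanced al x z.
Proof.
move=> [al_ge0 sum1] [inp tot loc].
pose x l := al l j0 / (sigma l j0 * p j0).
have sp0 l j : 0 < sigma l j * p j by rewrite mulr_gt0.
have x_ge0 l : 0 <= x l by rewrite divr_ge0// ltW.
have alE' i j : i != b -> al i j = sigma i j * p j * x i.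
  move=> ib; rewrite /x (inp i j0 j ib) mulrC divfK// gt_eqF//.
(* Square root of total balance, where proportionality lets [p j ^ 2] be factored out of the sum. *)
have albE j : al b j / sigma b j = p j * Num.sqrt (\sum_(i < K | i != b) x i ^+ 2).
  apply/eqP; rewrite -(eqrXn2 (n := 2))//; last 2 first.
  - by rewrite divr_ge0// ltW.
  - by rewrite mulr_ge0 ?sqrtr_ge0// ltW.
  rewrite tot exprMn sqr_sqrtr ?sumr_ge0// => [|i _]; last exact: sqr_ge0.
  rewrite mulr_sumr; apply/eqP/eq_bigr => i ib.
  by rewrite alE'//; field; rewrite gt_eqF.
have xbE : x b = Num.sqrt (\sum_(i < K | i != b) x i ^+ 2).
  rewrite /x invfM mulrA albE mulrAC divff ?mul1r// gt_eqF//.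
have alE l j : al l j = sigma l j * p j * x l.
  have [->|lb] := eqVneq l b; last exact: alE'.
  by rewrite xbE -mulrA -albE mulrC divfK// gt_eqF.
have xb2 : x b ^+ 2 = \sum_(i < K | i != b) x i ^+ 2.
  by rewrite xbE sqr_sqrtr// sumr_ge0// => i _; exact: sqr_ge0.
(* If [x b] were 0, total balance would make every [x l] vanish, against total budget 1. *)
have xb0 : 0 < x b.
  rewrite lt_neqAle x_ge0 andbT; apply/negP => /eqP xb0.
  have xz l : x l = 0.
    have [->//|lb] := eqVneq l b.
    move/eqP: xb2; rewrite -xb0 expr0n/= eq_sym psumr_eq0 => [|i _]; last exact: sqr_ge0.
    move=> /allP /(_ l (mem_index_enum l)); rewrite lb/= sqrf_eq0 => /eqP; exact.
  move: sum1; rewrite big1 => [/esym/eqP|i _]; first by rewrite oner_eq0.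
  by apply: big1 => j _; rewrite alE xz mulr0.
have al_gt0 l : 0 < x l -> forall j, 0 < al l j.
  by move=> xl j; rewrite alE mulr_gt0.
have [i1 i1b xi1] : exists2 i, i != b & 0 < x i.
  apply: contrapT => none; move: (exprn_gt0 2 xb0); rewrite xb2 big1 ?ltxx// => i ib.
  apply/eqP; rewrite sqrf_eq0 eq_le x_ge0 andbT leNgt; apply/negP => xi.
  by apply: none; exists i.
(* If [x l] were 0, the variance of [l] would be infinite and its quotient 0, while the quotient of
   [i1] is positive; local balance excludes this. *)
have x0 l : 0 < x l.
  have [->//|lb] := eqVneq l b.
  rewrite lt_neqAle x_ge0 andbT; apply/negP => /eqP xl.
  have li1 : i1 != l by apply: contraTN xi1 => /eqP ->; rewrite -xl ltxx.
  have := loc _ _ i1b lb li1.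
  rewrite -/(gap i1) -/(gap l) (local_ratio (al_gt0 _ xb0) (al_gt0 _ xi1)).
  rewrite (@mean_variance_pinfty l) => [|j]; last by rewrite alE -xl mulr0.
  rewrite (mean_variance_fin (al_gt0 _ xb0)) addey// invey mule0 => -[] /eqP.
  rewrite gt_eqF// divr_gt0 ?exprn_gt0 ?gap_gt0//.
  by rewrite addr_gt0// var_gt0// => j; rewrite mxE al_gt0.
have al0 l j : 0 < al l j by exact: al_gt0.
exists x, (g i1 (row b al) (row i1 al)); split=> // i ib.
have [->//|ii1] := eqVneq i i1.
have := loc _ _ ib i1b ii1.
rewrite -/(gap i) -/(gap i1) !local_ratio// => -[] h.
by rewrite !g_row// -[(var _ _ + _) *+ 2]mulr_natr -[X in _ = _ / X]mulr_natr
  !invfM !mulrA h.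
Qed.

(** * Equivalence with the derivative conditions *)

Let slope l j al : R := sigma l j ^+ 2 * p j ^+ 2 / al l j ^+ 2.
Let total_var i al : R := var b (row b al) + var i (row i al).

Let slope_gt0 l j al : (forall l j, 0 < al l j) -> 0 < slope l j al.
Proof. by move=> al0; rewrite divr_gt0 ?mulr_gt0 ?exprn_gt0. Qed.

Let total_var_gt0 i al : (forall l j, 0 < al l j) -> 0 < total_var i al.
Proof. by move=> al0; rewrite addr_gt0// var_gt0// => j; rewrite mxE. Qed.

(** Chain rule: [slope] is minus the derivative of the variance in the component, and the first
    factor is minus the derivative of [gap i ^ 2 / (2 V)] at [V = total_var i al]. *)
Lemma partial_iE al i j : i != b -> (forall l j, 0 < al l j) ->
  derivable_i g i j (row b al) (row i al) /\
  partial_i g i j (row b al) (row i al)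
  = gap i ^+ 2 / (total_var i al ^+ 2 *+ 2) * slope i j al.
Proof.
move=> ib al0.
have r0 l j' : 0 < row l al 0 j' by rewrite mxE.
have [|d e] := @derive_inverse_affine _ _ (g i (row b al)) (row i al)
  (delta_mx 0 j) (gap i ^+ 2) (sigma i j ^+ 2 * p j ^+ 2) (al i j) (total_var i al)
  (al0 i j) (total_var_gt0 i al0).
  have := shift_gt0 j (r0 i); apply: filterS => h h0.
  rewrite g_gt0// /var variance_sum_shift [row i al 0 j]mxE /total_var /var.
  by rewrite addrA.
split=> //; rewrite /partial_i e /slope; field.
by rewrite !gt_eqF// total_var_gt0.
Qed.

Lemma partial_bE al i j : i != b -> (forall l j, 0 < al l j) ->
  derivable_b g i j (row b al) (row i al) /\
  partial_b g i j (row b al) (row i al)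
  = gap i ^+ 2 / (total_var i al ^+ 2 *+ 2) * slope b j al.
Proof.
move=> ib al0.
have r0 l j' : 0 < row l al 0 j' by rewrite mxE.
have [|d e] := @derive_inverse_affine _ _ (fun a => g i a (row i al)) (row b al)
  (delta_mx 0 j) (gap i ^+ 2) (sigma b j ^+ 2 * p j ^+ 2) (al b j) (total_var i al)
  (al0 b j) (total_var_gt0 i al0).
  have := shift_gt0 j (r0 b); apply: filterS => h h0.
  rewrite g_gt0// /var variance_sum_shift [row b al 0 j]mxE /total_var /var.
  by rewrite addrAC.
split=> //; rewrite /partial_b e /slope; field.
by rewrite !gt_eqF// total_var_gt0.
Qed.

Let factor_gt0 i al : i != b -> (forall l j, 0 < al l j) ->
  0 < gap i ^+ 2 / (total_var i al ^+ 2 *+ 2).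
Proof.
move=> ib al0; rewrite divr_gt0 ?exprn_gt0 ?gap_gt0//.
by rewrite mulrn_wgt0// exprn_gt0// total_var_gt0.
Qed.

(** Both partial derivatives share the factor coming from the total variance, so total balance is a
    statement on slopes alone. *)
Let partial_ratio al i j : i != b -> (forall l j, 0 < al l j) ->
  partial_b g i j (row b al) (row i al) / partial_i g i j (row b al) (row i al)
  = slope b j al / slope i j al.
Proof.
move=> ib al0.
rewrite (partial_bE j ib al0).2 (partial_iE j ib al0).2 -mulf_div divff ?mul1r//.
by rewrite gt_eqF// factor_gt0.
Qed.

Let balanced_slope al x z l j : balanced al x z -> slope l j al = (x l ^+ 2)^-1.
Proof.
by case=> x0 alE _ _; rewrite /slope alE; field; rewrite !gt_eqF.
Qed.

Lemma balanced_derivative al x z : balanced al x z ->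
  [/\ input_balance g b al, total_balance g b al & local_balance g b al].
Proof.
move=> bal; have al0 := balanced_gt0 bal; have [x0 _ xb gz] := bal; split.
- move=> i j j' ib _; split; [exact: (partial_iE j ib al0).1
    | exact: (partial_iE j' ib al0).1 |].
  by rewrite !(partial_iE _ ib al0).2 !(balanced_slope _ _ bal).
- move=> j; split=> [i ib|].
    split; [exact: (partial_bE j ib al0).1 | exact: (partial_iE j ib al0).1 |].
    by rewrite (partial_iE _ ib al0).2 gt_eqF// mulr_gt0 ?factor_gt0 ?slope_gt0.
  transitivity (\sum_(i < K | i != b) (x b ^+ 2)^-1 * x i ^+ 2).
    by apply: eq_bigr => i ib; rewrite partial_ratio// !(balanced_slope _ _ bal) invrK.
  by rewrite -mulr_sumr -xb mulVf// gt_eqF// exprn_gt0.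
- by move=> i i' ib i'b _; rewrite !gz.
Qed.

(* At a zero component, [g] is constant on the left along some coordinate, so a
   partial derivative there, if any, vanishes. *)
Lemma total_balance_gt0 al : allocation al -> total_balance g b al ->
  forall l j, 0 < al l j.
Proof.
move=> [al_ge0 _] tot.
have pos i j : i != b -> 0 < al b j /\ 0 < al i j.
  move=> ib; apply/andP; rewrite -[_ && _]negbK negb_and -!leNgt; apply/negP => le0.
  have [_ di /negP] := (tot j).1 i ib; apply; apply/eqP.
  apply: derive_left_constant => // h h0.
  (* Lowering component [j] of the argument of [i] preserves whichever of the two components was
     nonpositive, so [g] stays 0. *)
  rewrite !(@g_le0 _ _ _ j) ?mxE//.
  case/orP: le0 => [->//|le0]; apply/orP; right.
  by rewrite !eqxx mulr1 -[0]addr0 lerD// ltW.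
move=> l j; have [->|lb] := eqVneq l b; last exact: (pos _ j lb).2.
by have [i ib] := exists_neq_b; exact: (pos i j ib).1.
Qed.

(** Once all components are positive, each slope is the inverse square of the ratio
    [al l j / (sigma l j * p j)], so the derivative conditions become equations between ratios. *)
Lemma derivative_balanced al : allocation al ->
  [/\ input_balance g b al, total_balance g b al & local_balance g b al] ->
  exists x z, balanced al x z.
Proof.
move=> aal [inp tot loc]; have al0 := total_balance_gt0 aal tot.
pose ratio l j := al l j / (sigma l j * p j).
have sp0 l j : 0 < sigma l j * p j by rewrite mulr_gt0.
have ratio0 l j : 0 < ratio l j by rewrite divr_gt0.
have alE l j : al l j = sigma l j * p j * ratio l j.
  by rewrite mulrC divfK// gt_eqF.
have slopeE l j : slope l j al = (ratio l j ^+ 2)^-1.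
  by rewrite /slope /ratio; field; rewrite !gt_eqF.
pose x l := if l == b then Num.sqrt (\sum_(i < K | i != b) ratio i j0 ^+ 2)
            else ratio l j0.
have [i1 i1b] := exists_neq_b.
have ratio_i i j : i != b -> ratio i j = ratio i j0.
  move=> ib; have [->//|jj0] := eqVneq j j0.
  (* Input balance is stated for [j < j'] only; [j0] has index 0, below every other index. *)
  have lt0 : (j0 < j)%N by rewrite lt0n; apply: contra jj0 => /eqP j00; apply/eqP/val_inj.
  have [_ _] := inp _ _ _ ib lt0; rewrite !(partial_iE _ ib al0).2 !slopeE.
  move/(mulfI (lt0r_neq0 (factor_gt0 ib al0)))/invr_inj/eqP.
  by rewrite eqrXn2 ?ltW// => /eqP.
have ratio_b j : ratio b j = Num.sqrt (\sum_(i < K | i != b) ratio i j0 ^+ 2).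
  have [_] := tot j.
  under eq_bigr => i ib do rewrite (partial_ratio _ ib al0) !slopeE invrK (ratio_i _ _ ib).
  rewrite -mulr_sumr => h.
  have -> : \sum_(i < K | i != b) ratio i j0 ^+ 2 = ratio b j ^+ 2.
    by rewrite -[LHS](mulVKf (lt0r_neq0 (exprn_gt0 2 (ratio0 b j)))) h mulr1.
  by rewrite sqrtr_sqr gtr0_norm.
exists x, (g i1 (row b al) (row i1 al)); split.
- by move=> l; rewrite /x; case: ifP => _; rewrite -?(ratio_b j0).
- move=> l j; rewrite alE /x; case: eqVneq => [->|lb]; first by rewrite ratio_b.
  by rewrite ratio_i.
- rewrite /x eqxx sqr_sqrtr ?sumr_ge0// => [|i _]; last exact: sqr_ge0.
  by apply: eq_bigr => i ib; rewrite (negbTE ib).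
- by move=> i ib; have [->//|ii1] := eqVneq i i1; exact: loc.
Qed.

(** Necessity of the conditions comes from existence and uniqueness, without Lagrange multipliers:
    an optimum coincides with the balanced allocation constructed above. *)
Lemma optimal_balanced al : optimal g b al -> exists x z, balanced al x z.
Proof.
have [al' [x [z [aal' bal']]]] := exists_balanced.
by move=> opt; rewrite (optimal_unique aal' bal' opt); exists x, z.
Qed.

End balance.

Theorem theorem1 (R : realType) (d : measure_display) (T : measurableType d)
    (P : probability T R) (K D : nat) (hK : (2 <= K)%N) (hD : (1 <= D)%N)
    (p : 'I_D -> R) (hp0 : forall j, 0 < p j) (hp1 : \sum_(j < D) p j = 1)
    (mu sigma : 'I_K -> 'I_D -> R) (hsigma : forall i j, 0 < sigma i j)
    (X : 'I_K -> 'I_D -> nat -> {RV P >-> R})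
    (hX : gaussian_outputs mu sigma X)
    (b : 'I_K) (hb : forall i, i != b -> mean p mu i < mean p mu b) :
  (forall alpha : 'M[R]_(K, D), allocation alpha ->
     (optimal (G p X b) b alpha <->
        [/\ input_balance (G p X b) b alpha,
            total_balance (G p X b) b alpha &
            local_balance (G p X b) b alpha]) /\
     ([/\ input_balance (G p X b) b alpha,
          total_balance (G p X b) b alpha &
          local_balance (G p X b) b alpha] <->
        [/\ input_balance_explicit p sigma b alpha,
            total_balance_explicit sigma b alpha &
            local_balance_explicit p mu sigma b alpha])) /\
  exists! alpha : 'M[R]_(K, D), optimal (G p X b) b alpha.

Proof.
have Gpos i (ab ai : 'rV[R]_D) : i != b -> (forall j, 0 < ab 0 j) -> (forall j, 0 < ai 0 j) ->
    G p X b i ab ai = (mean p mu b - mean p mu i) ^+ 2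
      / ((variance_sum p sigma b ab + variance_sum p sigma i ai) *+ 2).
  by move=> ib; apply: (G_gaussian hD hp0 hsigma hX ib); rewrite ltW// hb.
have Gneg i (ab ai : 'rV[R]_D) j : (ab 0 j <= 0) || (ai 0 j <= 0) -> G p X b i ab ai = 0.
  move=> le0; rewrite /G ifF//; apply/negP => /forallP/(_ j).
  by apply/negP; rewrite negb_and -!leNgt.
split=> [alpha aalpha|].
  (* Every implication passes through [balanced]. *)
  split; split.
  - by case/(optimal_balanced hK hD hp0 hsigma hb Gpos Gneg) => x [z];
      exact: (balanced_derivative hD hp0 hsigma hb Gpos).
  - case/(derivative_balanced hK hD hp0 hsigma hb Gpos Gneg aalpha) => x [z].
    exact: (balanced_optimal hK hD hp0 hsigma hb Gpos Gneg).
  - case/(derivative_balanced hK hD hp0 hsigma hb Gpos Gneg aalpha) => x [z].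
    exact: (balanced_explicit hD hp0 hsigma Gpos).
  - case/(explicit_balanced hD hp0 hsigma hb Gpos aalpha) => x [z].
    exact: (balanced_derivative hD hp0 hsigma hb Gpos).
have [al [x [z [aal bal]]]] := exists_balanced hK hD hp0 hsigma hb Gpos.
exists al; split; first exact: (balanced_optimal hK hD hp0 hsigma hb Gpos Gneg aal bal).
move=> al' opt; apply/esym.
exact: (optimal_unique hK hD hp0 hsigma hb Gpos Gneg aal bal opt).
Qed.
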